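(* Consider the 2D first-order Lax–Friedrichs scheme $$\bar{\mathbf U}_{ij}^{n+1}=\bar{\mathbf U}_{ij}^n-\frac{\Delta t_n}{\Delta x}\Big(\hat{\mathbf F}_1(\bar{\mathbf U}_{ij}^n,\bar{\mathbf U}_{i+1,j}^n)-\hat{\mathbf F}_1(\bar{\mathbf U}_{i-1,j}^n,\bar{\mathbf U}_{ij}^n)\Big)-\frac{\Delta t_n}{\Delta y}\Big(\hat{\mathbf F}_2(\bar{\mathbf U}_{ij}^n,\bar{\mathbf U}_{i,j+1}^n)-\hat{\mathbf F}_2(\bar{\mathbf U}_{i,j-1}^n,\bar{\mathbf U}_{ij}^n)\Big).$$ If for all $i$ and $j$, $\bar{\mathbf U}_{ij}^n\in\mathcal G$ and the discrete divergence-free condition $$\mathrm{div}_{ij}\bar{\mathbf B}^n:=\frac{(\bar B_1)_{i+1,j}^n-(\bar B_1)_{i-1,j}^n}{2\Delta x}+\frac{(\bar B_2)_{i,j+1}^n-(\bar B_2)_{i,j-1}^n}{2\Delta y}=0$$ holds, then the solution $\bar{\mathbf U}_{ij}^{n+1}$ of the scheme always belongs to $\mathcal G$ under the CFL condition $$0<\frac{\alpha_{1,n}^{LF}\Delta t_n}{\Delta x}+\frac{\alpha_{2,n}^{LF}\Delta t_n}{\Delta y}\le1,$$ where the parameters $\alpha_{1,n}^{LF},\alpha_{2,n}^{LF}$ satisfy $$\alpha_{1,n}^{LF}>\max_{i,j}\alpha_1(\bar{\mathbf U}_{i+1,j}^n,\bar{\mathbf U}_{i-1,j}^n),\qquad \alpha_{2,n}^{LF}>\max_{i,j}\alpha_2(\bar{\mathbf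 U}_{i,j+1}^n,\bar{\mathbf U}_{i,j-1}^n).$$
   Context: A state is $\mathbf U=(\rho,\mathbf m,\mathbf B,E)^\top\in\mathbb R^8$ with $\rho,E\in\mathbb R$, $\mathbf m,\mathbf B\in\mathbb R^3$. For $\rho>0$ put $\mathbf v=\mathbf m/\rho$, $\mathcal E(\mathbf U)=E-\frac12\big(\frac{|\mathbf m|^2}{\rho}+|\mathbf B|^2\big)$, $e=\mathcal E(\mathbf U)/\rho$, $p=p(\rho,e)$, $p_{tot}=p+\frac{|\mathbf B|^2}{2}$. The equation of state $p(\rho,e)$ is any function such that, whenever $\rho>0$, one has $e>0\Leftrightarrow p(\rho,e)>0$. Admissible states: $\mathcal G=\{\mathbf U:\rho>0,\ \mathcal E(\mathbf U)>0\}$. Flux: $$\mathbf F_\ell(\mathbf U)=\big(\rho v_\ell,\ \rho v_\ell\mathbf v-B_\ell\mathbf B+p_{tot}\mathbf e_\ell,\ v_\ell\mathbf B-B_\ell\mathbf v,\ v_\ell(E+p_{tot})-B_\ell(\mathbf v\cdot\mathbf B)\big)^\top,$$ with $\mathbf e_\ell$ the $\ell$-th standard unit vector of $\mathbb R^3$. LF flux: $\hat{\mathbf F}_\ell(\mathbf U^-,\mathbf U^+)=\frac12\big(\mathbf F_\ell(\mathbf U^-)+\mathbf F_\ell(\mathbf U^+)-\alpha_{\ell,n}^{LF}(\mathbf U^+-\mathbf U^-)\big)$. For $\mathbf U,\tilde{\mathbf U}\in\mathcal G$, $\alpha_\ell(\mathbf U,\tilde{\mathbf U})=\min_{\sigma\in\mathbb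 R}\alpha_\ell(\mathbf U,\tilde{\mathbf U};\sigma)$ with $$\alpha_\ell(\mathbf U,\tilde{\mathbf U};\sigma)=\max\big\{|v_\ell|+\mathscr C_\ell,\ |\tilde v_\ell|+\tilde{\mathscr C}_\ell,\ |\sigma v_\ell+(1-\sigma)\tilde v_\ell|+\max\{\mathscr C_\ell,\tilde{\mathscr C}_\ell\}\big\}+\frac{|\tilde{\mathbf B}-\mathbf B|}{\sqrt2}\sqrt{\frac{\sigma^2}{\rho}+\frac{(1-\sigma)^2}{\tilde\rho}},$$ $$\mathscr C_\ell=\frac1{\sqrt2}\Big[\mathscr C_s^2+\frac{|\mathbf B|^2}{\rho}+\sqrt{\Big(\mathscr C_s^2+\frac{|\mathbf B|^2}{\rho}\Big)^2-4\frac{\mathscr C_s^2B_\ell^2}{\rho}}\Big]^{1/2},\qquad \mathscr C_s=\frac{p}{\rho\sqrt{2e}},$$ and $\tilde{\mathscr C}_\ell$ the same quantity for $\tilde{\mathbf U}$. The mesh is uniform rectangular with spacings $\Delta x,\Delta y>0$ and cell indices $(i,j)\in\mathbb Z^2$ (maxima over indices understood as suprema); $(\bar B_k)_{ij}^n$ is the $k$-th magnetic component of $\bar{\mathbf U}_{ij}^n$. *)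

(* Defs.v *)
From HB Require Import structures.
From mathcomp Require Import all_boot all_order all_algebra.
From mathcomp Require Import all_classical all_reals all_analysis.

Set Implicit Arguments.
Unset Strict Implicit.
Unset Printing Implicit Defensive.

Import Order.TTheory GRing.Theory Num.Theory.

Local Open Scope classical_set_scope.
Local Open Scope ring_scope.

(* Euclidean structure on R^3; the norm `|_| of the library on matrices is the
   sup norm, hence the explicit definition. *)
Definition dot (R : realType) (u v : 'cV[R]_3) : R := \sum_k u k 0 * v k 0.

Definition enorm (R : realType) (u : 'cV[R]_3) : R := Num.sqrt (dot u u).

(* U = (rho, m, B, E)^T; the dimension is convertible to 8. *)
Notation state R := 'cV[R]_(1 + (3 + (3 + 1))).

Definition mk_state (R : realType) (r : R) (m B : 'cV[R]_3) (E : R) : state R :=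
  col_mx r%:M (col_mx m (col_mx B E%:M)).

Definition density (R : realType) (U : state R) : R := usubmx U 0 0.

Definition momentum (R : realType) (U : state R) : 'cV[R]_3 :=
  usubmx (dsubmx U).

Definition magnetic (R : realType) (U : state R) : 'cV[R]_3 :=
  usubmx (dsubmx (dsubmx U)).

Definition total_energy (R : realType) (U : state R) : R :=
  dsubmx (dsubmx (dsubmx U)) 0 0.

Definition velocity (R : realType) (U : state R) : 'cV[R]_3 :=
  (density U)^-1 *: momentum U.

(* Internal energy per unit volume. *)
Definition internal_energy (R : realType) (U : state R) : R :=
  total_energy U -
  (enorm (momentum U) ^+ 2 / density U + enorm (magnetic U) ^+ 2) / 2.

Definition specific_energy (R : realType) (U : state R) : R :=
  internal_energy U / density U.

Definition admissible (R : realType) : set (state R) :=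
  [set U | 0 < density U /\ 0 < internal_energy U].

(* The arguments of p are the density and the specific internal energy. *)
Definition is_eos (R : realType) (p : R -> R -> R) : Prop :=
  forall r e : R, 0 < r -> (0 < e <-> 0 < p r e).

Definition pressure (R : realType) (p : R -> R -> R) (U : state R) : R :=
  p (density U) (specific_energy U).

Definition total_pressure (R : realType) (p : R -> R -> R) (U : state R) : R :=
  pressure p U + enorm (magnetic U) ^+ 2 / 2.

(* The direction l is 0-based: F_1, F_2, F_3 are at 0, 1, 2 : 'I_3. *)
Definition flux (R : realType) (p : R -> R -> R) (l : 'I_3) (U : state R) :
    state R :=
  let v := velocity U in
  let B := magnetic U in
  let ptot := total_pressure p U in
  mk_state (density U * v l 0)
           ((density U * v l 0) *: v - B l 0 *: B + ptot *: delta_mx l 0)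
           (v l 0 *: B - B l 0 *: v)
           (v l 0 * (total_energy U + ptot) - B l 0 * dot v B).

Definition lf_flux (R : realType) (p : R -> R -> R) (a : R) (l : 'I_3)
    (Um Up : state R) : state R :=
  2^-1 *: (flux p l Um + flux p l Up - a *: (Up - Um)).

Definition sound_speed (R : realType) (p : R -> R -> R) (U : state R) : R :=
  pressure p U / (density U * Num.sqrt (2 * specific_energy U)).

Definition fast_speed (R : realType) (p : R -> R -> R) (l : 'I_3)
    (U : state R) : R :=
  let s := sound_speed p U ^+ 2 + enorm (magnetic U) ^+ 2 / density U in
  (Num.sqrt 2)^-1 *
  Num.sqrt (s + Num.sqrt (s ^+ 2 -
    4 * (sound_speed p U ^+ 2 * magnetic U l 0 ^+ 2 / density U))).

Definition alpha_at (R : realType) (p : R -> R -> R) (l : 'I_3)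
    (U V : state R) (sigma : R) : R :=
  let c := fast_speed p l U in
  let d := fast_speed p l V in
  let u := velocity U l 0 in
  let v := velocity V l 0 in
  Num.max (`|u| + c)
    (Num.max (`|v| + d)
             (`|sigma * u + (1 - sigma) * v| + Num.max c d)) +
  enorm (magnetic V - magnetic U) / Num.sqrt 2 *
  Num.sqrt (sigma ^+ 2 / density U + (1 - sigma) ^+ 2 / density V).

(* On admissible states the set is nonempty and bounded below by 0, and the
   infimum is attained: [alpha_at] is continuous in sigma and either constant
   or coercive. *)
Definition alpha (R : realType) (p : R -> R -> R) (l : 'I_3)
    (U V : state R) : R :=
  inf (range (alpha_at p l U V)).

Definition lf_step (R : realType) (p : R -> R -> R) (dx dy dt a1 a2 : R)
    (U : int -> int -> state R) (i j : int) : state R :=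
  U i j
  - (dt / dx) *: (lf_flux p a1 0 (U i j) (U (i + 1) j)
                  - lf_flux p a1 0 (U (i - 1) j) (U i j))
  - (dt / dy) *: (lf_flux p a2 1 (U i j) (U i (j + 1))
                  - lf_flux p a2 1 (U i (j - 1)) (U i j)).

Definition discrete_div (R : realType) (dx dy : R)
    (U : int -> int -> state R) (i j : int) : R :=
  (magnetic (U (i + 1) j) 0 0 - magnetic (U (i - 1) j) 0 0) / (2 * dx)
  + (magnetic (U i (j + 1)) 1 0 - magnetic (U i (j - 1)) 1 0) / (2 * dy).

(* The suprema over all cells are taken in the extended reals: the supremum of
   an unbounded family is +oo, whereas [sup] in R would return a dummy value. *)
Definition max_alpha1 (R : realType) (p : R -> R -> R)
    (U : int -> int -> state R) : \bar R :=
  ereal_sup [set (alpha p 0 (U (ij.1 + 1) ij.2) (U (ij.1 - 1) ij.2))%:E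
            | ij in [set: int * int]].

Definition max_alpha2 (R : realType) (p : R -> R -> R)
    (U : int -> int -> state R) : \bar R :=
  ereal_sup [set (alpha p 1 (U ij.1 (ij.2 + 1)) (U ij.1 (ij.2 - 1)))%:E
            | ij in [set: int * int]].

(* Main.v *)
Require Import Defs.
From HB Require Import structures.
From mathcomp Require Import all_boot all_order all_algebra.
From mathcomp Require Import all_classical all_reals all_analysis.
From mathcomp Require Import ring lra.

Import Order.TTheory GRing.Theory Num.Theory.

Local Open Scope classical_set_scope.
Local Open Scope ring_scope.

(** The admissible set has an equivalent description by conditions that are
    affine in the state: a state U of positive density is admissible if and
    only if, for all v and B in R^3,
      U . n + |B|^2 / 2 > 0   with   n = (|v|^2 / 2, - v, - B, 1),
    because the left side ([rel_energy v B U]) equals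
      rho |u - v|^2 / 2 + |B_U - B|^2 / 2 + internal energy,
    where u and B_U are the velocity and the magnetic field of U
    ([rel_energyE], [admissible_rel_energy]).  The Lax-Friedrichs update can
    therefore be tested against one functional at a time.  Applied to it, any
    linear functional splits into a nonnegative multiple of the old cell value
    and positive multiples of the two pairs of opposite neighbours, each pair
    U, V occurring only as  a (U + V) - (F(U) - F(V))  ([lf_step_linear]).

    The core is thus a two-state inequality ([lf_pair_rel_energy_gt0]).  The
    flux tested against n ([pairing_flux]) is a transport term, plus a
    quadratic form in the deviations (u - v, B_U - B), plus two remainders.
    - The quadratic form is at most the fast speed times the relative energy:
      the square of the fast speed is the larger root of the
      magnetosonic dispersion relation, and the particular form p / (rho sqrt(2e))
      of the sound speed lets the pressure term be paired with the internal
      energy ([wave_form_norm_le]).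
    - The magnetic energy is transported by v rather than by u.  Writing v as
      the sigma-average of the velocities of U and V minus the sigma-average of
      the deviations costs the middle speed in alpha and a cubic term, which
      the jump |B_V - B_U| controls ([magnetic_jump_le]).
    - The remainder in |B|^2 / 2 is the same for U and V and cancels; the
      other one leaves (B_U - B_V)_l (v . B).
    The terms of this last kind do not have a sign, but in the update they add
    up to dt (v . B) times the discrete divergence, which is zero. *)

(** * Euclidean geometry of three-dimensional vectors *)

Section Dot.
Context {R : realType}.
Implicit Types (u v w : 'cV[R]_3) (k : R) (l : 'I_3).

Lemma dot_coord u v : dot u v = u 0 0 * v 0 0 + u 1 0 * v 1 0 + u 2 0 * v 2 0.
Proof.
rewrite /dot !big_ord_recl big_ord0 addr0 addrA.
by congr (_ + u _ _ * v _ _ + u _ _ * v _ _); apply/val_inj.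
Qed.

Lemma dotC u v : dot u v = dot v u.
Proof. by apply: eq_bigr => k _; rewrite mulrC. Qed.

Lemma dotDl u v w : dot (u + v) w = dot u w + dot v w.
Proof. by rewrite !dot_coord !mxE; ring. Qed.

Lemma dotZl k u w : dot (k *: u) w = k * dot u w.
Proof. by rewrite !dot_coord !mxE; ring. Qed.

Lemma dotNl u w : dot (- u) w = - dot u w.
Proof. by rewrite !dot_coord !mxE; ring. Qed.

Lemma dotDr u v w : dot w (u + v) = dot w u + dot w v.
Proof. by rewrite !dot_coord !mxE; ring. Qed.

Lemma dotZr k u w : dot w (k *: u) = k * dot w u.
Proof. by rewrite !dot_coord !mxE; ring. Qed.

Lemma dotNr u w : dot w (- u) = - dot w u.
Proof. by rewrite !dot_coord !mxE; ring. Qed.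

Definition dotE := (dotDl, dotDr, dotZl, dotZr, dotNl, dotNr).

Lemma dot_delta l u : dot u (delta_mx l 0) = u l 0.
Proof.
rewrite /dot (bigD1 l) //= big1 ?mxE ?eqxx ?mulr1 ?addr0 // => k kl.
by rewrite mxE (negbTE kl) mulr0.
Qed.

Lemma dot_ge0 u : 0 <= dot u u.
Proof. by apply: sumr_ge0 => k _; rewrite -expr2 sqr_ge0. Qed.

Lemma enorm_sqr u : enorm u ^+ 2 = dot u u.
Proof. by rewrite sqr_sqrtr ?dot_ge0. Qed.

Lemma enorm_ge0 u : 0 <= enorm u.
Proof. exact: sqrtr_ge0. Qed.

(** Lagrange's identity: the defect is the squared norm of the cross product. *)
Lemma dot_cauchy_schwarz u v : dot u v ^+ 2 <= dot u u * dot v v.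
Proof.
rewrite -subr_ge0 !dot_coord.
have -> : forall a b c x y z : R,
  (a * a + b * b + c * c) * (x * x + y * y + z * z)
   - (a * x + b * y + c * z) ^+ 2 =
  (a * y - b * x) ^+ 2 + (b * z - c * y) ^+ 2 + (c * x - a * z) ^+ 2.
  by move=> *; ring.
by rewrite !addr_ge0 ?sqr_ge0.
Qed.

Lemma coord_sqr_le l u : u l 0 ^+ 2 <= dot u u.
Proof.
have := dot_cauchy_schwarz u (delta_mx l 0).
by rewrite !dot_delta mxE !eqxx mulr1.
Qed.

(** Cauchy-Schwarz for the projections orthogonal to the l-th axis. *)
Lemma tangential_cauchy_schwarz l u v :
  (dot u v - u l 0 * v l 0) ^+ 2
    <= (dot u u - u l 0 ^+ 2) * (dot v v - v l 0 ^+ 2).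
Proof.
pose t (x : 'cV[R]_3) : 'cV[R]_3 := x - x l 0 *: delta_mx l 0.
have tE (x y : 'cV[R]_3) : dot (t x) (t y) = dot x y - x l 0 * y l 0.
  have dl (z : 'cV[R]_3) : dot (delta_mx l 0) z = z l 0 by rewrite dotC dot_delta.
  by rewrite !dotE !dl !dot_delta mxE !eqxx /=; ring.
have := dot_cauchy_schwarz (t u) (t v).
by rewrite !tE -!expr2.
Qed.

End Dot.

(** * Two facts on real quadratic expressions *)

Section QuadraticForms.
Context {R : realType}.

Lemma binary_form_ge0 (a b c x y : R) : 0 <= a -> 0 <= c -> b ^+ 2 <= a * c ->
  0 <= a * x ^+ 2 + 2 * b * x * y + c * y ^+ 2.
Proof.
move=> a0 c0 bac.
have [a_eq0|aN0] := eqVneq a 0.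
  have b0 : b = 0.
    by apply/eqP; rewrite -sqrf_eq0; apply/eqP/le_anti; rewrite sqr_ge0 andbT;
       move: bac; rewrite a_eq0 mul0r.
  by rewrite a_eq0 b0 !(mul0r, mulr0, add0r) mulr_ge0 ?sqr_ge0.
have ap : 0 < a by rewrite lt0r aN0.
rewrite -(pmulr_rge0 _ ap).
have -> : a * (a * x ^+ 2 + 2 * b * x * y + c * y ^+ 2)
  = (a * x + b * y) ^+ 2 + (a * c - b ^+ 2) * y ^+ 2 by ring.
by apply: addr_ge0; [exact: sqr_ge0 | rewrite mulr_ge0 ?subr_ge0 ?sqr_ge0].
Qed.

Lemma ge0_of_mul_add (x y : R) : 0 <= x * y -> 0 <= x + y -> 0 <= x /\ 0 <= y.
Proof.
move=> xy0 s0; split; rewrite leNgt; apply/negP => h.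
  have y0 : 0 < y by lra.
  by move: xy0; rewrite leNgt nmulr_rlt0 ?y0.
have x0 : 0 < x by lra.
by move: xy0; rewrite leNgt pmulr_rlt0 ?h.
Qed.

End QuadraticForms.

(** * The fast speed as a bound for the wave part of the flux *)

Section State.
Context {R : realType}.
Context (p : R -> R -> R) (hp : is_eos p).
Implicit Types (U V : state R) (v B w b : 'cV[R]_3) (l : 'I_3).

Lemma specific_energy_gt0 U : admissible U -> 0 < specific_energy U.
Proof. by case=> ? ?; rewrite divr_gt0. Qed.

Lemma pressure_gt0 U : admissible U -> 0 < pressure p U.
Proof.
move=> hU; have [e_to_p _] := hp (density U) (specific_energy U) (proj1 hU).
exact/e_to_p/specific_energy_gt0.
Qed.

Lemma sound_speed_gt0 U : admissible U -> 0 < sound_speed p U.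
Proof.
move=> hU; rewrite divr_gt0 ?pressure_gt0// mulr_gt0 ?(proj1 hU)//.
by rewrite sqrtr_gt0 mulr_gt0 // specific_energy_gt0.
Qed.

(** With c the fast speed, c^2 is a root of the dispersion relation
    x^2 - (a + |B|^2 / rho) x + a B_l^2 / rho = 0; being at least half the sum
    of the roots, it is the larger one.  The square root in the definition is
    genuine because B_l^2 <= |B|^2 makes the discriminant nonnegative. *)
Lemma fast_speed_root l U : admissible U ->
  let r := density U in let a := sound_speed p U ^+ 2 in
  let bb := dot (magnetic U) (magnetic U) in let bl := magnetic U l 0 in
  let c2 := fast_speed p l U ^+ 2 in
  [/\ 0 < fast_speed p l U, a + bb / r <= 2 * c2 &
      c2 ^+ 2 - (a + bb / r) * c2 + a * bl ^+ 2 / r = 0].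
Proof.
move=> hU r a bb bl c2.
have r0 : 0 < r by case: hU.
have a0 : 0 < a by rewrite exprn_gt0 ?sound_speed_gt0.
have bb0 : 0 <= bb / r by rewrite divr_ge0 ?dot_ge0 ?ltW.
have blbb : bl ^+ 2 / r <= bb / r by rewrite ler_pM2r ?invr_gt0 ?coord_sqr_le.
have bl0 : 0 <= bl ^+ 2 / r by rewrite divr_ge0 ?sqr_ge0 ?ltW.
set s := a + bb / r in c2 *.
set q := s ^+ 2 - 4 * (a * bl ^+ 2 / r).
have s0 : 0 < s by rewrite /s; lra.
have q0 : 0 <= q.
  have -> : q = (s + (a + bl ^+ 2 / r)) * (bb / r - bl ^+ 2 / r)
                + (a - bl ^+ 2 / r) ^+ 2 by rewrite /q /s; ring.
  by rewrite addr_ge0 ?sqr_ge0 ?mulr_ge0 ?subr_ge0 // /s; lra.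
have cE : fast_speed p l U = (Num.sqrt 2)^-1 * Num.sqrt (s + Num.sqrt q).
  by rewrite /fast_speed /= enorm_sqr.
have sq0 : 0 < s + Num.sqrt q by have := sqrtr_ge0 q; lra.
have c2E : c2 = (s + Num.sqrt q) / 2.
  by rewrite /c2 cE exprMn exprVn !sqr_sqrtr ?(ltW sq0) // mulrC.
split.
- by rewrite cE mulr_gt0 ?invr_gt0 ?sqrtr_gt0.
- by rewrite c2E; have := sqrtr_ge0 q; lra.
- have qE : Num.sqrt q ^+ 2 = s ^+ 2 - 4 * (a * bl ^+ 2 / r) by rewrite sqr_sqrtr.
  have -> : c2 ^+ 2 - s * c2 + a * bl ^+ 2 / r
    = (Num.sqrt q ^+ 2 - (s ^+ 2 - 4 * (a * bl ^+ 2 / r))) / 4.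
    by rewrite c2E; field; rewrite gt_eqF.
  by rewrite qE subrr mul0r.
Qed.

(** The l-th flux of the induction equation for velocity w and field B. *)
Definition induction_flux l w B := w l 0 *: B - B l 0 *: w.

(** The matrix of this quadratic form in w has c^2 as its largest eigenvalue
    (c the fast speed) once w is scaled by sqrt rho.  In terms of w_l and the
    tangential part of w, the difference of the two sides is bounded below by
    a binary form whose determinant vanishes by the dispersion relation, and
    whose diagonal coefficients are nonnegative because c^2 is the larger root
    of that relation. *)
Lemma induction_flux_sqr_le l U w : admissible U ->
  dot (induction_flux l w (magnetic U)) (induction_flux l w (magnetic U))
  + sound_speed p U ^+ 2 * density U * w l 0 ^+ 2
    <= fast_speed p l U ^+ 2 * (density U * dot w w).
Proof.
move=> hU; have [_ Hs Hr] := fast_speed_root l U hU.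
have r0 : 0 < density U by case: hU.
move: Hs Hr => /=.
set B := magnetic U; set r := density U in r0 *.
set a := _ ^+ 2; set c := _ ^+ 2 => Hs Hr.
set bb := dot B B in Hs Hr.
have bt0 : 0 <= bb - B l 0 ^+ 2 by rewrite subr_ge0 coord_sqr_le.
have wt0 : 0 <= dot w w - w l 0 ^+ 2 by rewrite subr_ge0 coord_sqr_le.
(* P and D below are the diagonal coefficients of the binary form, and
   [Hmul] says that its determinant vanishes. *)
have Hmul : (r * (c - a) - (bb - B l 0 ^+ 2)) * (r * c - B l 0 ^+ 2)
           = B l 0 ^+ 2 * (bb - B l 0 ^+ 2).
  have -> : (r * (c - a) - (bb - B l 0 ^+ 2)) * (r * c - B l 0 ^+ 2) =
    r ^+ 2 * (c ^+ 2 - (a + bb / r) * c + a * B l 0 ^+ 2 / r)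
      + B l 0 ^+ 2 * (bb - B l 0 ^+ 2) by field; rewrite gt_eqF.
  by rewrite Hr mulr0 add0r.
have [P0 D0] : 0 <= r * (c - a) - (bb - B l 0 ^+ 2) /\ 0 <= r * c - B l 0 ^+ 2.
  apply: ge0_of_mul_add; first by rewrite Hmul mulr_ge0 ?sqr_ge0.
  have : 0 <= r * (2 * c - (a + bb / r)) by rewrite mulr_ge0 ?subr_ge0 // ltW.
  have -> : r * (2 * c - (a + bb / r)) = r * 2 * c - r * a - bb.
    by field; rewrite gt_eqF.
  lra.
set P := _ - (bb - _) in Hmul P0; set D := _ - _ in Hmul D0.
have CS := tangential_cauchy_schwarz l B w.
set x := dot B w - _ in CS.
have xy : `|x| <= Num.sqrt (bb - B l 0 ^+ 2) * Num.sqrt (dot w w - w l 0 ^+ 2).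
  by rewrite -sqrtrM // -sqrtr_sqr ler_wsqrtr.
set y := Num.sqrt (dot w w - _) in xy.
have y2 : y ^+ 2 = dot w w - w l 0 ^+ 2 by rewrite sqr_sqrtr.
set g := Num.sqrt (bb - _) in xy.
have g2 : g ^+ 2 = bb - B l 0 ^+ 2 by rewrite sqr_sqrtr.
have := binary_form_ge0 P (- `|B l 0| * g) D `|w l 0| y P0 D0.
have H1 : (- `|B l 0| * g) ^+ 2 <= P * D.
  by rewrite Hmul exprMn g2 sqrrN real_normK ?num_real.
move=> /(_ H1) H2.
have H3 : - (w l 0 * B l 0 * x) <= `|w l 0| * `|B l 0| * (g * y).
  apply: le_trans (ler_norm _) _; rewrite normrN !normrM.
  by apply: ler_wpM2l; rewrite ?mulr_ge0.
have -> : dot (induction_flux l w B) (induction_flux l w B) =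
  w l 0 ^+ 2 * bb - 2 * w l 0 * B l 0 * dot B w + B l 0 ^+ 2 * dot w w.
  by rewrite /induction_flux !dotE (dotC w B) -/bb; ring.
have : 0 <= P * w l 0 ^+ 2 + D * (dot w w - w l 0 ^+ 2) + 2 * (w l 0 * B l 0 * x).
  rewrite -y2 -(real_normK (num_real (w l 0))).
  apply: le_trans H2 _; rewrite -subr_ge0.
  set t := w l 0 * B l 0 * x in H3 *.
  have -> : forall n b : R,
    P * n ^+ 2 + D * y ^+ 2 + 2 * t - (P * n ^+ 2 + 2 * (- b * g) * n * y + D * y ^+ 2)
    = 2 * (n * b * (g * y) - - t) by move=> n b; ring.
  by rewrite mulr_ge0 // subr_ge0.
rewrite -(subr_ge0 _ (c * _)) /P /D /x /bb => H4.
by apply: le_trans H4 _; rewrite le_eqVlt; apply/orP; left; apply/eqP; ring.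
Qed.

(** Young's inequality with weight c, the fast speed, for both products: the
    squares of b and of theta = sqrt(2e) give back the magnetic and internal
    energies, and the squares of the other factors are what
    [induction_flux_sqr_le] bounds.  The pressure factors as
    C_s rho theta, C_s being the sound speed. *)
Lemma wave_form_le l U w b : admissible U ->
  pressure p U * w l 0 + dot b (induction_flux l w (magnetic U))
    <= fast_speed p l U *
       (density U * dot w w / 2 + dot b b / 2 + internal_energy U).
Proof.
move=> hU; have [C0 _ _] := fast_speed_root l U hU.
have := induction_flux_sqr_le l U w hU.
move: (induction_flux _ _ _) => u; set C := fast_speed _ _ _ in C0 *.
have r0 : 0 < density U by case: hU.
have e0 := specific_energy_gt0 U hU.
set th := Num.sqrt (2 * specific_energy U).
have th0 : 0 < th by rewrite sqrtr_gt0 mulr_gt0.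
have pE : pressure p U = sound_speed p U * density U * th.
  by rewrite /sound_speed -/th; field; rewrite !gt_eqF.
have iE : internal_energy U = density U * th ^+ 2 / 2.
  have -> : th ^+ 2 = 2 * specific_energy U by rewrite sqr_sqrtr // mulr_ge0 // ltW.
  by rewrite /specific_energy; field; rewrite gt_eqF.
rewrite pE iE; set r := density U in r0 *; set a := sound_speed p U => Hs.
have H1 : 0 <= dot (C *: b - u) (C *: b - u) by exact: dot_ge0.
have H2 : 0 <= r * (C * th - a * w l 0) ^+ 2 by rewrite mulr_ge0 ?sqr_ge0 ?ltW.
have H3 : dot (C *: b - u) (C *: b - u)
    = C ^+ 2 * dot b b - 2 * C * dot b u + dot u u.
  by rewrite !dotE (dotC u b); ring.
rewrite H3 in H1; rewrite -(ler_pM2l C0) -subr_ge0.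
have -> : C * (C * (r * dot w w / 2 + dot b b / 2 + r * th ^+ 2 / 2))
  - C * (a * r * th * w l 0 + dot b u) =
  ((C ^+ 2 * (r * dot w w) - (dot u u + a ^+ 2 * r * w l 0 ^+ 2)) +
   (C ^+ 2 * dot b b - 2 * C * dot b u + dot u u) +
   r * (C * th - a * w l 0) ^+ 2) / 2 by field.
apply: divr_ge0 => //; apply: addr_ge0 => //; apply: addr_ge0 => //.
by rewrite subr_ge0.
Qed.

(** The form is odd in w, hence the bound on its absolute value. *)
Lemma wave_form_norm_le l U w b : admissible U ->
  `|pressure p U * w l 0 + dot b (induction_flux l w (magnetic U))|
    <= fast_speed p l U *
       (density U * dot w w / 2 + dot b b / 2 + internal_energy U).
Proof.
move=> hU; rewrite ler_norml wave_form_le // andbT lerNl.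
have := wave_form_le l U (- w) b hU; congr (_ <= _).
  by rewrite !dotE mxE; ring.
by rewrite !dotE; ring.
Qed.

(** * The affine description of admissible states *)

(** The scalar product of U with (|v|^2 / 2, - v, - B, 1). *)
Definition pairing v B U : R :=
  density U * (dot v v / 2) - dot v (momentum U) - dot B (magnetic U)
  + total_energy U.

Lemma densityD U V : density (U + V) = density U + density V.
Proof. by rewrite /density linearD mxE. Qed.

Lemma densityZ k U : density (k *: U) = k * density U.
Proof. by rewrite /density linearZ mxE. Qed.

Lemma pairingD v B U V : pairing v B (U + V) = pairing v B U + pairing v B V.
Proof.
rewrite /pairing densityD /momentum /magnetic /total_energy !linearD /= !mxE.
by rewrite !dotE; ring.
Qed.

Lemma pairingZ v B k U : pairing v B (k *: U) = k * pairing v B U.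
Proof.
rewrite /pairing densityZ /momentum /magnetic /total_energy !linearZ /= !mxE.
by rewrite !dotE; ring.
Qed.

Lemma density_mk_state (r : R) m B (E : R) : density (mk_state r m B E) = r.
Proof. by rewrite /density /mk_state col_mxKu mxE eqxx mulr1n. Qed.

Lemma pairing_mk_state v B (r : R) m b (E : R) :
  pairing v B (mk_state r m b E) = r * (dot v v / 2) - dot v m - dot B b + E.
Proof.
rewrite /pairing density_mk_state /momentum /magnetic /total_energy /mk_state.
by rewrite !(col_mxKd, col_mxKu) mxE eqxx mulr1n.
Qed.

Definition rel_energy v B U : R := pairing v B U + dot B B / 2.

Lemma total_energyE U : total_energy U = internal_energy U
   + (dot (momentum U) (momentum U) / density U + dot (magnetic U) (magnetic U)) / 2.
Proof. by rewrite /internal_energy !enorm_sqr subrK. Qed.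

Lemma momentumE U : 0 < density U -> momentum U = density U *: velocity U.
Proof. by move=> r0; rewrite /velocity scalerA divff ?scale1r ?gt_eqF. Qed.

Lemma rel_energyE v B U : 0 < density U ->
  rel_energy v B U =
  density U * dot (velocity U - v) (velocity U - v) / 2
  + dot (magnetic U - B) (magnetic U - B) / 2 + internal_energy U.
Proof.
move=> r0; rewrite /rel_energy /pairing total_energyE momentumE //.
move: (velocity U) (magnetic U) => vU BU.
rewrite !dotE (dotC vU v) (dotC BU B).
by field; rewrite gt_eqF.
Qed.

Lemma rel_energy_gt0 v B U : admissible U -> 0 < rel_energy v B U.
Proof.
move=> [r0 i0]; rewrite rel_energyE // ltr_wpDl //.
by rewrite addr_ge0 ?divr_ge0 ?mulr_ge0 ?dot_ge0 // ltW.
Qed.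

(** At v and B the velocity and magnetic field of U itself, the relative energy
    is the internal energy. *)
Lemma admissible_rel_energy U : 0 < density U ->
  (forall v B, 0 < rel_energy v B U) -> admissible U.
Proof.
move=> r0 /(_ (velocity U) (magnetic U)); rewrite rel_energyE // !subrr.
by rewrite !dot_coord !mxE !(mulr0, mul0r, addr0, add0r); split.
Qed.

(** The split is arranged so that every term is either bounded by the relative
    energy or harmless in a difference of two fluxes.  The kinetic and internal
    energies travel with the velocity of U, whereas the magnetic deviation
    travels with the test velocity v: the magnetic pressure turns the factor
    u_l of |b|^2 / 2 into v_l.  The part - v_l |B|^2 / 2 does not depend on
    U, and the part B_l (v . B) is what the divergence condition handles. *)
Lemma pairing_flux l v B U : 0 < density U ->
  let w := velocity U - v in let b := magnetic U - B in
  pairing v B (flux p l U) =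
    velocity U l 0 * (density U * dot w w / 2 + internal_energy U)
    + v l 0 * (dot b b / 2)
    + (pressure p U * w l 0
       + dot b (induction_flux l w (magnetic U)))
    - v l 0 * (dot B B / 2) + magnetic U l 0 * dot v B.
Proof.
move=> r0 w b; rewrite /flux /= pairing_mk_state /total_pressure enorm_sqr.
rewrite total_energyE momentumE // /w /b /induction_flux.
move: (velocity U) (magnetic U) => vU BU.
rewrite !dotE !dot_delta !mxE.
rewrite (dotC vU v) (dotC BU B) (dotC vU BU) (dotC BU v) (dotC v B) (dotC B vU).
by field; rewrite gt_eqF.
Qed.

(** * The two-state inequality *)

Lemma alpha_at_ge0 l U V s : admissible U -> admissible V ->
  0 <= alpha_at p l U V s.
Proof.
move=> hU hV; have [c0 _ _] := fast_speed_root l U hU.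
apply: addr_ge0; last by rewrite mulr_ge0 ?divr_ge0 ?enorm_ge0 ?sqrtr_ge0.
by rewrite le_max addr_ge0 // ltW.
Qed.

Lemma velocity_lt_alpha_at l U V s : admissible U -> admissible V ->
  `|velocity U l 0| < alpha_at p l U V s /\ `|velocity V l 0| < alpha_at p l U V s.
Proof.
move=> hU hV; have [c0 _ _] := fast_speed_root l U hU.
have [d0 _ _] := fast_speed_root l V hV.
rewrite /alpha_at /=; set S := _ / _ * _.
have S0 : 0 <= S by rewrite mulr_ge0 ?divr_ge0 ?enorm_ge0 ?sqrtr_ge0.
by split; apply: ltr_wpDr => //; rewrite !lt_max ltrDl ?c0 ?d0 ?orbT.
Qed.

(** The cubic term: |b1|^2 - |b2|^2 = (b1 - b2) . (b1 + b2) is of first order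
    in the jump of the magnetic field, and |b1 + b2|^2 is at most
    2 (|b1|^2 + |b2|^2), which gives the factor |b2 - b1| / sqrt 2.  The
    averaged velocity is estimated by Cauchy-Schwarz with the densities as
    weights. *)
Lemma magnetic_jump_le (s r1 r2 w1 w2 Q : R) (b1 b2 : 'cV[R]_3) :
  0 < r1 -> 0 < r2 ->
  (r1 * w1 ^+ 2 + r2 * w2 ^+ 2 + dot b1 b1 + dot b2 b2) / 2 <= Q ->
  `|(s * w1 + (1 - s) * w2) * (dot b1 b1 / 2 - dot b2 b2 / 2)|
   <= enorm (b2 - b1) / Num.sqrt 2 *
      Num.sqrt (s ^+ 2 / r1 + (1 - s) ^+ 2 / r2) * Q.
Proof.
move=> r10 r20 hQ; set t := 1 - s.
set x := r1 * w1 ^+ 2 + r2 * w2 ^+ 2.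
set y := dot b1 b1 + dot b2 b2.
set S2 := s ^+ 2 / r1 + t ^+ 2 / r2.
have x0 : 0 <= x by rewrite addr_ge0 // mulr_ge0 ?sqr_ge0 // ltW.
have y0 : 0 <= y by rewrite addr_ge0 ?dot_ge0.
have S0 : 0 <= S2 by rewrite addr_ge0 // divr_ge0 ?sqr_ge0 // ltW.
have Q0 : 0 <= Q by apply: le_trans hQ; rewrite -addrA divr_ge0 // addr_ge0.
have hw : (s * w1 + t * w2) ^+ 2 <= S2 * x.
  rewrite -subr_ge0.
  have -> : S2 * x - (s * w1 + t * w2) ^+ 2
    = (s * r2 * w2 - t * r1 * w1) ^+ 2 / (r1 * r2).
    by rewrite /S2 /x; field; rewrite !gt_eqF.
  by rewrite divr_ge0 ?sqr_ge0 // mulr_ge0 ?ltW.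
have hb : (dot b1 b1 / 2 - dot b2 b2 / 2) ^+ 2 <= dot (b2 - b1) (b2 - b1) / 2 * y.
  have -> : dot b1 b1 / 2 - dot b2 b2 / 2 = - dot (b2 - b1) (b2 + b1) / 2.
    by rewrite !dotE (dotC b1 b2); field.
  rewrite expr_div_n sqrrN.
  have := dot_cauchy_schwarz (b2 - b1) (b2 + b1).
  have := dot_ge0 (b2 - b1).
  have : dot (b2 - b1) (b2 - b1) + dot (b2 + b1) (b2 + b1) = 2 * y.
    by rewrite /y !dotE (dotC b1 b2); ring.
  set D1 := dot _ _; set D2 := dot _ _; set D3 := dot _ _ => h1 h2 h3.
  have : D1 * D2 <= D1 * (2 * y) by apply: ler_wpM2l => //; lra.
  lra.
have hxy : x * y <= Q ^+ 2.
  have : ((x + y) / 2) ^+ 2 <= Q ^+ 2.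
    rewrite ler_sqr ?nnegrE //; first by rewrite /x /y addrA.
    by rewrite divr_ge0 // addr_ge0.
  by apply: le_trans; have := sqr_ge0 (x - y); lra.
rewrite -(@ler_pXn2r _ 2) ?nnegrE //; last first.
  by rewrite !mulr_ge0 ?invr_ge0 ?enorm_ge0 ?sqrtr_ge0.
rewrite real_normK ?num_real // !exprMn exprVn enorm_sqr !sqr_sqrtr //.
apply: (@le_trans _ _ (S2 * x * (dot (b2 - b1) (b2 - b1) / 2 * y))).
  by apply: ler_pM; rewrite ?sqr_ge0.
have -> : S2 * x * (dot (b2 - b1) (b2 - b1) / 2 * y)
   = dot (b2 - b1) (b2 - b1) / 2 * S2 * (x * y) by ring.
by apply: ler_wpM2l => //; rewrite mulr_ge0 ?divr_ge0 ?dot_ge0.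
Qed.

(** The bookkeeping behind the speed alpha: k is the kinetic plus internal
    energy, m the magnetic energy and q the wave part of each state.  The test
    velocity v is s v1 + (1 - s) v2 minus the averaged deviation; the first part
    is absorbed by M, and the second one by J. *)
Lemma flux_balance (a M J s v v1 v2 c1 c2 k1 k2 m1 m2 q1 q2 : R) :
  0 <= k1 -> 0 <= k2 -> 0 <= m1 -> 0 <= m2 -> 0 < k1 + m1 + (k2 + m2) ->
  `|v1| + c1 <= M -> `|v2| + c2 <= M ->
  `|s * v1 + (1 - s) * v2| + c1 <= M -> `|s * v1 + (1 - s) * v2| + c2 <= M ->
  `|q1| <= c1 * (k1 + m1) -> `|q2| <= c2 * (k2 + m2) ->
  `|(s * (v1 - v) + (1 - s) * (v2 - v)) * (m1 - m2)|
    <= J * (k1 + m1 + (k2 + m2)) ->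
  M + J < a ->
  v1 * k1 + v * m1 + q1 - (v2 * k2 + v * m2 + q2) < a * (k1 + m1 + (k2 + m2)).
Proof.
move=> k10 k20 m10 m20 Q0 M1 M2 M3 M4 hq1 hq2 hJ ha.
have {}ha : (M + J) * (k1 + m1 + (k2 + m2)) < a * (k1 + m1 + (k2 + m2)).
  by rewrite ltr_pM2r.
set vs := s * v1 + (1 - s) * v2 in M3 M4.
have vsE : v = vs - (s * (v1 - v) + (1 - s) * (v2 - v)) by rewrite /vs; ring.
set ws := s * (v1 - v) + _ in vsE hJ.
have N1 := ler_wpM2r k10 (ler_norm v1).
have N2 : - v2 * k2 <= `|v2| * k2.
  by rewrite ler_wpM2r // -normrN ler_norm.
have N3 : vs * m1 <= `|vs| * m1 by rewrite ler_wpM2r // ler_norm.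
have N4 : - vs * m2 <= `|vs| * m2 by rewrite ler_wpM2r // -normrN ler_norm.
have N5 : q1 <= `|q1| := ler_norm _.
have N6 : - q2 <= `|q2| by rewrite -normrN ler_norm.
have N7 : - (ws * (m1 - m2)) <= `|ws * (m1 - m2)| by rewrite -normrN ler_norm.
have P1 := ler_wpM2r k10 M1; have P2 := ler_wpM2r k20 M2.
have P3 := ler_wpM2r m10 M3; have P4 := ler_wpM2r m20 M4.
have -> : v1 * k1 + v * m1 + q1 - (v2 * k2 + v * m2 + q2)
  = v1 * k1 - v2 * k2 + q1 - q2 + v * (m1 - m2) by ring.
have -> : v * (m1 - m2) = vs * m1 - vs * m2 - ws * (m1 - m2).
  by rewrite {1}vsE; ring.
clearbody vs ws; lra.
Qed.

Lemma alpha_lt_ex l U V a : alpha p l U V < a -> exists s, alpha_at p l U V s < a.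
Proof.
move=> h; have [|_ [s _ <-] hs] := inf_lt _ h; first by exists (alpha_at p l U V 0), 0.
by exists s.
Qed.

(** The last term is the trace of a jump of the normal magnetic field: v and B
    being arbitrary, it takes both signs, and only the sum over the two
    directions of the mesh is under control. *)
Lemma lf_pair_rel_energy_gt0 l U V a v B : admissible U -> admissible V ->
  alpha p l U V < a ->
  0 < a * (rel_energy v B U + rel_energy v B V)
      - (pairing v B (flux p l U) - pairing v B (flux p l V))
      + (magnetic U l 0 - magnetic V l 0) * dot v B.
Proof.
move=> hU hV /alpha_lt_ex[s ha].
have [r1 i1] := hU; have [r2 i2] := hV.
have e1 := rel_energy_gt0 v B U hU; have e2 := rel_energy_gt0 v B V hV.
have q1 := wave_form_norm_le l U (velocity U - v) (magnetic U - B) hU.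
have q2 := wave_form_norm_le l V (velocity V - v) (magnetic V - B) hV.
rewrite !pairing_flux // !rel_energyE // in e1 e2 *.
move: q1 q2 e1 e2.
set w1 := velocity U - v; set w2 := velocity V - v.
set b1 := magnetic U - B; set b2 := magnetic V - B.
set q1 := _ + dot b1 _; set q2 := _ + dot b2 _.
have k1 := coord_sqr_le l w1; have k2 := coord_sqr_le l w2.
have := magnetic_jump_le s _ _ (w1 l 0) (w2 l 0)
  (density U * dot w1 w1 / 2 + dot b1 b1 / 2 + internal_energy U +
   (density V * dot w2 w2 / 2 + dot b2 b2 / 2 + internal_energy V)) b1 b2 r1 r2.
have -> : b2 - b1 = magnetic V - magnetic U by rewrite /b1 /b2 opprB addrA subrK.
move: ha; rewrite /alpha_at /=.
set J := _ * Num.sqrt _; set M := Num.max _ _ => ha.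
have w1E : w1 l 0 = velocity U l 0 - v l 0 by rewrite /w1 !mxE.
have w2E : w2 l 0 = velocity V l 0 - v l 0 by rewrite /w2 !mxE.
rewrite {}w1E {}w2E in k1 k2 *.
have [M1 M2 M3 M4] : [/\ `|velocity U l 0| + fast_speed p l U <= M,
  `|velocity V l 0| + fast_speed p l V <= M,
  `|s * velocity U l 0 + (1 - s) * velocity V l 0| + fast_speed p l U <= M &
  `|s * velocity U l 0 + (1 - s) * velocity V l 0| + fast_speed p l V <= M].
  by rewrite /M; split; rewrite !le_max ?lexx ?orbT // ?lerD2l !le_max lexx ?orbT.
have [i10 i20] := (ltW i1, ltW i2).
move: (dot_ge0 w1) (dot_ge0 w2) (dot_ge0 b1) (dot_ge0 b2) => W1 W2 D1 D2 hJ.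
have kin1 : density U * (velocity U l 0 - v l 0) ^+ 2 <= density U * dot w1 w1.
  by rewrite ler_pM2l.
have kin2 : density V * (velocity V l 0 - v l 0) ^+ 2 <= density V * dot w2 w2.
  by rewrite ler_pM2l.
have {}hJ := hJ ltac:(lra).
have T1 := mulr_ge0 (ltW r1) W1; have T2 := mulr_ge0 (ltW r2) W2.
move=> hq1 hq2 e1 e2.
have := flux_balance a M J s (v l 0) (velocity U l 0) (velocity V l 0)
  (fast_speed p l U) (fast_speed p l V)
  (density U * dot w1 w1 / 2 + internal_energy U)
  (density V * dot w2 w2 / 2 + internal_energy V)
  (dot b1 b1 / 2) (dot b2 b2 / 2) q1 q2
  ltac:(lra) ltac:(lra) ltac:(lra) ltac:(lra) ltac:(lra) M1 M2 M3 M4.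
have E (x y z : R) : x / 2 + y + z / 2 = x / 2 + z / 2 + y by rewrite addrAC.
rewrite !E => /(_ hq1 hq2 hJ ha); rewrite -subr_gt0 => /lt_le_trans; apply.
by rewrite le_eqVlt; apply/orP; left; apply/eqP; ring.
Qed.

Lemma alpha_lt_gt0 l U V a : admissible U -> admissible V ->
  alpha p l U V < a -> 0 < a.
Proof.
by move=> hU hV /alpha_lt_ex[s]; apply: le_lt_trans; exact: alpha_at_ge0.
Qed.

Lemma lf_pair_density_gt0 l U V a : admissible U -> admissible V ->
  alpha p l U V < a ->
  0 < a * (density U + density V) - (density (flux p l U) - density (flux p l V)).
Proof.
move=> hU hV /alpha_lt_ex[s hs].
have [hu hv] := velocity_lt_alpha_at l U V s hU hV.
rewrite !density_mk_state.
have -> : a * (density U + density V)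
    - (density U * velocity U l 0 - density V * velocity V l 0)
  = density U * (a - velocity U l 0) + density V * (a + velocity V l 0) by ring.
rewrite addr_gt0 // mulr_gt0 ?(proj1 hU) ?(proj1 hV) //.
  by rewrite subr_gt0; apply: le_lt_trans (lt_trans hu hs); exact: ler_norm.
rewrite -[velocity V l 0]opprK subr_gt0; apply: le_lt_trans (lt_trans hv hs).
by rewrite -normrN ler_norm.
Qed.

End State.

(** * The scheme *)

Lemma lt_max_alpha1 (R : realType) (p : R -> R -> R) (U : int -> int -> state R)
  (a : R) (i j : int) : (max_alpha1 p U < a%:E)%E ->
  alpha p 0 (U (i + 1) j) (U (i - 1) j) < a.
Proof.
move=> h; rewrite -lte_fin; apply: le_lt_trans h.
by apply: ereal_sup_ubound; exists (i, j).
Qed.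

Lemma lt_max_alpha2 (R : realType) (p : R -> R -> R) (U : int -> int -> state R)
  (a : R) (i j : int) : (max_alpha2 p U < a%:E)%E ->
  alpha p 1 (U i (j + 1)) (U i (j - 1)) < a.
Proof.
move=> h; rewrite -lte_fin; apply: le_lt_trans h.
by apply: ereal_sup_ubound; exists (i, j).
Qed.

(** In each direction the numerical fluxes on the two sides share the term in
    F(U_ij), which cancels, while their viscous parts remove the fraction
    a dt / dx of the cell value; this is where the time step restriction comes
    from. *)
Lemma lf_step_linear (R : realType) (p : R -> R -> R) (dx dy dt a1 a2 : R)
    (U : int -> int -> state R) (i j : int) (f : state R -> R) :
  0 < dx -> 0 < dy ->
  (forall V W, f (V + W) = f V + f W) -> (forall k V, f (k *: V) = k * f V) ->
  f (lf_step p dx dy dt a1 a2 U i j) =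
  (1 - (a1 * dt / dx + a2 * dt / dy)) * f (U i j)
  + dt / (2 * dx) * (a1 * (f (U (i + 1) j) + f (U (i - 1) j))
      - (f (flux p 0 (U (i + 1) j)) - f (flux p 0 (U (i - 1) j))))
  + dt / (2 * dy) * (a2 * (f (U i (j + 1)) + f (U i (j - 1)))
      - (f (flux p 1 (U i (j + 1))) - f (flux p 1 (U i (j - 1))))).
Proof.
move=> dx0 dy0 fD fZ; have fN V : f (- V) = - f V by rewrite -scaleN1r fZ mulN1r.
rewrite /lf_step /lf_flux !(fD, fN, fZ).
by field; rewrite !gt_eqF.
Qed.

Theorem theorem4p3 (R : realType) (p : R -> R -> R) (hp : is_eos p)
    (dx dy : R) (hdx : 0 < dx) (hdy : 0 < dy)
    (dt a1 a2 : nat -> R) (U : nat -> int -> int -> state R) (n : nat)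
    (hscheme : forall i j : int,
       U n.+1 i j = lf_step p dx dy (dt n) (a1 n) (a2 n) (U n) i j)
    (hU : forall i j : int, admissible (U n i j))
    (hdiv : forall i j : int, discrete_div dx dy (U n) i j = 0)
    (ha1 : (max_alpha1 p (U n) < (a1 n)%:E)%E)
    (ha2 : (max_alpha2 p (U n) < (a2 n)%:E)%E)
    (hcfl : 0 < a1 n * dt n / dx + a2 n * dt n / dy <= 1) :
  forall i j : int, admissible (U n.+1 i j).
Proof.
move=> i j; rewrite hscheme.
set a := a1 n in ha1 hcfl *; set b := a2 n in ha2 hcfl *.
have hE := lt_max_alpha1 _ _ _ _ i j ha1.
have hN := lt_max_alpha2 _ _ _ _ i j ha2.
have a0 : 0 < a := alpha_lt_gt0 _ hp _ _ _ _ (hU _ _) (hU _ _) hE.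
have b0 : 0 < b := alpha_lt_gt0 _ hp _ _ _ _ (hU _ _) (hU _ _) hN.
case/andP: hcfl => hcfl0 hcfl1.
(* Both speeds being positive, the lower bound in the CFL condition fixes the
   sign of the time step. *)
have t0 : 0 < dt n.
  have sE : a * dt n / dx + b * dt n / dy = (a / dx + b / dy) * dt n by ring.
  by move: hcfl0; rewrite sE pmulr_rgt0 // addr_gt0 // divr_gt0.
have mu0 : 0 <= 1 - (a * dt n / dx + b * dt n / dy) by rewrite subr_ge0.
have tx0 : 0 < dt n / (2 * dx) by rewrite divr_gt0 ?mulr_gt0.
have ty0 : 0 < dt n / (2 * dy) by rewrite divr_gt0 ?mulr_gt0.
apply: admissible_rel_energy => [|v B].
  rewrite lf_step_linear //; [|exact: densityD|exact: densityZ].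
  rewrite -addrA ltr_wpDl ?mulr_ge0 ?(ltW (proj1 (hU _ _))) //.
  by apply: addr_gt0; apply: mulr_gt0 => //;
    apply: (lf_pair_density_gt0 _ hp); rewrite ?hU.
have posE := lf_pair_rel_energy_gt0 _ hp _ _ _ _ v B (hU _ _) (hU _ _) hE.
have posN := lf_pair_rel_energy_gt0 _ hp _ _ _ _ v B (hU _ _) (hU _ _) hN.
rewrite /rel_energy lf_step_linear //; [|exact: pairingD|exact: pairingZ].
set q := dot v B in posE posN *.
have posC := rel_energy_gt0 v B _ (hU i j).
have := hdiv i j; rewrite /discrete_div.
set dB1 := magnetic _ 0 0 - _ in posE *; set dB2 := magnetic _ 1 0 - _ in posN *.
move=> div0.
set GE := pairing v B (flux _ _ _) - _ in posE *.
set GN := pairing v B (flux _ _ (U n i (j + 1))) - _ in posN *.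
rewrite {}/rel_energy in posE posN posC.
(* The relative energies and the divergence terms combine into the goal plus
   dt (v . B) times the discrete divergence. *)
apply: (@lt_le_trans _ _
  ((1 - (a * dt n / dx + b * dt n / dy)) * (pairing v B (U n i j) + dot B B / 2)
   + (dt n / (2 * dx) * (a * (pairing v B (U n (i + 1) j) + dot B B / 2
        + (pairing v B (U n (i - 1) j) + dot B B / 2)) - GE + dB1 * q)
   + dt n / (2 * dy) * (b * (pairing v B (U n i (j + 1)) + dot B B / 2
        + (pairing v B (U n i (j - 1)) + dot B B / 2)) - GN + dB2 * q)))).
  by rewrite ltr_wpDl ?mulr_ge0 ?(ltW posC) // addr_gt0 // mulr_gt0.
rewrite -[leRHS]addr0 -[X in _ <= _ + X](mul0r (dt n * q)) -div0.
by rewrite le_eqVlt; apply/orP; left; apply/eqP; field; rewrite !gt_eqF.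
Qed.
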